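(* Let $M$ be an $\mathbb{O}$-bimodule. The real part operator has the following expression in terms of scalar multiplications: $$\operatorname{Re}x=\frac{5}{12}x-\frac1{12}\sum_{i=1}^7e_ixe_i\qquad(x\in M).$$ Moreover, for all $x\in M$: (1) $\operatorname{Re}^2x=\operatorname{Re}x$. (2) For all $p,q\in\mathbb{O}$, $\operatorname{Re}(p\operatorname{Re}(x))=(\operatorname{Re}p)\operatorname{Re}(x)$ and $\operatorname{Re}[p,q,x]=\operatorname{Re}[p,x]=0$. (3) $x=\sum_{i=0}^7e_i\operatorname{Re}(\overline{e_i}x)$.
   Context: $\mathbb{O}$ is the real algebra of octonions with standard basis $e_0=1,e_1,\dots,e_7$, with conjugation $\overline{x_0+\sum_{i\ge1} x_ie_i}=x_0-\sum_{i\ge1} x_ie_i$ and real part $\operatorname{Re}p=p_0$ for $p\in\mathbb{O}$. A left $\mathbb{O}$-module is a real vector space $M$ with an $\mathbb{R}$-bilinear unital multiplication $\mathbb{O}\times M\to M$ with $r(rm)=r^2m$ for all $r\in\mathbb{O}$, $m\in M$. Put $[p,q,m]=(pq)m-p(qm)$. An $\mathbb{O}$-bimodule is a left $\mathbb{O}$-module with an $\mathbb{R}$-bilinear unital right multiplication such that $[p,q,m]=[m,p,q]=[q,m,p]$ for all $p,q\in\mathbb O,m\in M$, where $[m,p,q]=(mp)q-m(pq)$, $[q,m,p]=(qm)p-q(mp)$ (so $(e_ix)e_i=e_i(xe_i)$, written $e_ixe_i$). Also $[p,x]=px-xp$. For an $\mathbb{O}$-bimodule $M$ let $\mathscr{A}(M)=\{m:[p,q,m]=0\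 \forall p,q\in\mathbb{O}\}$; it is known that $M=\bigoplus_{i=0}^7e_i\mathscr{A}(M)$ and that $\mathscr{A}(M)=\{m:pm=mp\ \forall p\in\mathbb{O}\}$. The real part operator $\operatorname{Re}:M\to\mathscr{A}(M)$ is the projection $\sum_{i=0}^7e_ix_i\mapsto x_0$ ($x_i\in\mathscr{A}(M)$). *)

(* Defs.v *)
From HB Require Import structures.
From mathcomp Require Import all_boot all_order all_algebra.
From mathcomp Require Import classical_sets reals.

Set Implicit Arguments.
Unset Strict Implicit.
Unset Printing Implicit Defensive.

Import GRing.Theory.

Local Open Scope classical_set_scope.
Local Open Scope ring_scope.

Notation octonion R := 'rV[R]_8.

(* The triples (i, j, k) with e_i e_j = e_k = - e_j e_i, up to cyclic
   permutation. *)
Definition oct_triples : seq (nat * nat * nat) :=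
  [:: (1, 2, 3); (1, 4, 5); (1, 7, 6); (2, 4, 6); (2, 5, 7); (3, 4, 7);
      (3, 6, 5)]%N.

Definition oct_cyclic (i j k : nat) : bool :=
  [|| (i, j, k) \in oct_triples, (j, k, i) \in oct_triples
    | (k, i, j) \in oct_triples].

(* e_i e_j = \sum_k oct_const i j k e_k *)
Definition oct_const (R : realType) (i j k : 'I_8) : R :=
  if i == ord0 then (j == k)%:R
  else if j == ord0 then (i == k)%:R
  else if k == ord0 then - (i == j)%:R
  else (oct_cyclic i j k)%:R - (oct_cyclic j i k)%:R.

Definition oct_mul (R : realType) (p q : octonion R) : octonion R :=
  \row_k \sum_i \sum_j p ord0 i * q ord0 j * oct_const R i j k.

Notation "p *O q" := (oct_mul p q) (at level 40, left associativity).

Definition oct_e (R : realType) (i : 'I_8) : octonion R := delta_mx ord0 i.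

Definition oct_re (R : realType) (p : octonion R) : R := p ord0 ord0.

Definition oct_conj (R : realType) (p : octonion R) : octonion R :=
  \row_k (if k == ord0 then p ord0 k else - p ord0 k).

HB.mixin Record isOctLmodule (R : realType) M of GRing.Lmodule R M := {
  lact : octonion R -> M -> M;
  lact_linearl : forall m : M, linear (fun p => lact p m);
  lact_linearr : forall p : octonion R, linear (lact p);
  lact1 : forall m : M, lact (oct_e R ord0) m = m;
  lact_alt : forall (r : octonion R) (m : M),
    lact r (lact r m) = lact (r *O r) m
}.

#[short(type="octLmodType")]
HB.structure Definition OctLmodule (R : realType) :=
  {M of isOctLmodule R M & GRing.Lmodule R M}.

Notation "p *L m" := (lact p m) (at level 40, left associativity).

Definition lassoc (R : realType) (M : octLmodType R) (p q : octonion R)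
  (m : M) : M := (p *O q) *L m - p *L (q *L m).

HB.mixin Record isOctBimodule (R : realType) M of OctLmodule R M := {
  ract : M -> octonion R -> M;
  ract_linearl : forall p : octonion R, linear (fun m => ract m p);
  ract_linearr : forall m : M, linear (ract m);
  ract1 : forall m : M, ract m (oct_e R ord0) = m;
  lassoc_rassoc : forall (p q : octonion R) (m : M),
    lassoc p q m = ract (ract m p) q - ract m (p *O q);
  lassoc_massoc : forall (p q : octonion R) (m : M),
    lassoc p q m = ract (q *L m) p - q *L (ract m p)
}.

#[short(type="octBimodType")]
HB.structure Definition OctBimodule (R : realType) :=
  {M of isOctBimodule R M & OctLmodule R M}.

Notation "m *R p" := (ract m p) (at level 40, left associativity).

Definition commutator (R : realType) (M : octBimodType R) (p : octonion R)
  (x : M) : M := p *L x - x *R p.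

(* The set A(M) of associative elements. *)
Definition assoc_elt (R : realType) (M : octLmodType R) : set M :=
  [set m | forall p q : octonion R, lassoc p q m = 0].

(* [re x] is the component c_0 of the decomposition x = \sum_i e_i c_i with
   all c_i in A(M); such a decomposition exists and is unique since
   M = \bigoplus_i e_i A(M), so the default value 0 is never used. *)
Definition re (R : realType) (M : octBimodType R) (x : M) : M :=
  xget 0 [set y | exists c : 'I_8 -> M,
    [/\ forall i, assoc_elt (c i), x = \sum_i oct_e R i *L c i & y = c ord0]].

Lemma lact0 (R : realType) (M : octLmodType R) (p : octonion R) :
  p *L (0 : M) = 0.
Proof. by have := @lact_linearr R M p (- 1) 0 0; rewrite !scaleN1r !addNr. Qed.

Lemma re_assoc (R : realType) (M : octBimodType R) (x : M) : assoc_elt (re x).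
Proof.
rewrite /re; case: xgetP => [y _ [c [Ac _ ->]]|_ p q]; first exact: Ac.
by rewrite /lassoc !lact0 subrr.
Qed.

(* Main.v *)
Require Import Defs.
From HB Require Import structures.
From mathcomp Require Import all_boot all_order all_algebra.
From mathcomp Require Import ssrAC ring.
From mathcomp Require Import classical_sets reals.

Set Implicit Arguments.
Unset Strict Implicit.
Unset Printing Implicit Defensive.

Import GRing.Theory Num.Theory.

Local Open Scope ring_scope.

(** Write L_i and R_i for the left and right multiplications by e_i on the
    bimodule M, L_p and R_p for those by an octonion p, and A(p, q) for the
    operator x |-> [p, q, x].

    The alternative law makes L_1, ..., L_7 anticommuting square roots of -1
    (lact_sq, lact_swap), so M is a module over the Clifford algebra Cl_7.  The
    point of the proof is that the bimodule axioms leave no freedom beyond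
    this.

    First, right multiplications are polynomials in the left ones.  Computing
    ((x p) q) r and ((q x) p) r in two ways each and eliminating the terms in
    which a right multiplication meets an associator gives
    x [p, q, r] as an expression in left multiplications only
    (ract_associator).  Every imaginary unit is half of an associator of three
    units, and in this way one finds (ev_ract)
      4 x e_i = \sum_j e_j ((conj(e_j) e_i) x) - 4 e_i x.

    Secondly, the relation R_1^2 = -1, once R_1 is expressed in the L_i, forces
    L_1 L_2 ... L_7 = -1 (act_imag_units).  Of the two kinds of Clifford
    modules, only that of the regular representation survives.  Modulo this
    relation and up to sign, each word in the L_i is a strictly increasing word of
    length at most 3; there are 1 + 7 + 21 + 35 = 64 of these, and they form a
    basis of the algebra M_8 of all operators on the octonions.  Hence an
    identity between multiplication operators that is true in the octonions can
    be proved in M by comparing coefficients of normal forms.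

    Let T x (re_op) be the right-hand side of the formula for the real part.  By this
    principle A(e_i, e_j) T = 0, T A(e_i, e_j) = 0, T (L_i - R_i) = 0 and
    \sum_i L_i T L_(conj e_i) = 1, so T takes values in A(M) and provides a
    decomposition of each x along the e_i A(M).  On an element c of A(M) a word
    in the L_i acts as a single +- e_k, whence T (e_i c) is c for i = 0 and 0
    otherwise (re_op_lact_nuclear).  This makes the component c_0 unique and
    equal to T x. *)

(** * Linear maps given by a proof of linearity *)

Section LinearMaps.
Variables (R : realType) (U V : lmodType R) (f : U -> V).
Hypothesis lf : linear f.

Lemma linD u v : f (u + v) = f u + f v.
Proof. by have := lf 1 u v; rewrite !scale1r. Qed.

Lemma lin0 : f 0 = 0.
Proof. by apply: (addrI (f 0)); rewrite -linD !addr0. Qed.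

Lemma linZ a u : f (a *: u) = a *: f u.
Proof. by have := lf a u 0; rewrite lin0 !addr0. Qed.

Lemma linB u v : f (u - v) = f u - f v.
Proof. by rewrite -scaleN1r linD linZ scaleN1r. Qed.

Lemma lin_sum I r (P : pred I) E :
  f (\sum_(i <- r | P i) E i) = \sum_(i <- r | P i) f (E i).
Proof. exact: (big_morph f linD lin0). Qed.

End LinearMaps.

(** * The multiplication table of the octonions *)

(** An explicit list, because [enum 'I_8] does not reduce and the finite checks
    below are done by evaluation. *)
Definition oct_indices : seq 'I_8 := [seq inZp i | i <- iota 0 8].

(** The seven triples of the multiplication table are the lines of the Fano
    plane, and their numbering makes each of them sum to 0 under bitwise
    exclusive or; hence e_i e_j is always plus or minus e_(i xor j). *)
Definition oxor (i j : 'I_8) : 'I_8 := inZp (Nat.lxor i j).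

Definition osgn (i j : 'I_8) : bool :=
  (i != ord0) && (i == j) || oct_cyclic j i (oxor i j).

Lemma oct_indicesE : oct_indices = enum 'I_8.
Proof. by apply: (inj_map val_inj); rewrite val_enum_ord. Qed.

Lemma all_indices (P : pred 'I_8) : all P oct_indices -> forall i, P i.
Proof. by rewrite oct_indicesE => /allP Pi i; apply: Pi; rewrite mem_enum. Qed.

Lemma all_indices2 (P : 'I_8 -> pred 'I_8) :
  all (fun i => all (P i) oct_indices) oct_indices -> forall i j, P i j.
Proof. by move/all_indices => Pij i; apply: all_indices; apply: Pij. Qed.

Lemma big_indices (V : nmodType) (F : 'I_8 -> V) :
  \sum_i F i = \sum_(i <- oct_indices) F i.
Proof. by rewrite oct_indicesE big_enum. Qed.

Section OctonionTable.
Variable R : realType.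
Implicit Types p q r : octonion R.
Local Notation e := (oct_e R).

Lemma oct_constE i j k :
  oct_const R i j k = (-1) ^+ osgn i j * (k == oxor i j)%:R.
Proof.
pose P i j k := if i == ord0 then ~~ osgn i j && ((j == k) == (k == oxor i j))
  else if j == ord0 then ~~ osgn i j && ((i == k) == (k == oxor i j))
  else if k == ord0 then ((i == j) == (k == oxor i j)) && ((i == j) ==> osgn i j)
  else (oct_cyclic i j k == (k == oxor i j) && ~~ osgn i j)
    && (oct_cyclic j i k == (k == oxor i j) && osgn i j).
have: P i j k.
  suff: all (fun i => all (fun j => all (P i j) oct_indices) oct_indices) oct_indices.
    by move/all_indices2/(_ i j)/all_indices.
  by vm_compute.
rewrite /P /oct_const; case: ifP => _; last case: ifP => _; last case: ifP => _.
- by case/andP=> /negbTE-> /eqP->; rewrite mul1r.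
- by case/andP=> /negbTE-> /eqP->; rewrite mul1r.
- by case/andP=> /eqP<-; case: (i == j) => [/= ->|]; rewrite ?mulN1r ?mulr0 ?oppr0.
- case/andP=> /eqP-> /eqP->.
  by case: (k == _); case: osgn; rewrite ?mulr0 ?subrr ?mulr1 ?subr0 ?sub0r.
Qed.

Lemma oct_mul_basis i j : e i *O e j = (-1) ^+ osgn i j *: e (oxor i j).
Proof.
apply/rowP => k; rewrite !mxE (bigD1 i) //= [X in _ + X]big1 ?addr0; last first.
  move=> i' /negbTE ni; apply: big1 => j' _.
  by rewrite !mxE ni andbF !mul0r.
rewrite (bigD1 j) //= [X in _ + X]big1 ?addr0.
  by rewrite !mxE !eqxx !mul1r oct_constE.
by move=> j' /negbTE nj; rewrite !mxE nj andbF mulr0 mul0r.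
Qed.

Lemma oct_basis p : p = \sum_i p ord0 i *: e i.
Proof. exact: row_sum_delta. Qed.

Lemma oct_mul_linearl q : linear (fun p => p *O q).
Proof.
move=> a p p'; apply/rowP => k; rewrite !mxE mulr_sumr -big_split.
apply: eq_bigr => i _; rewrite mulr_sumr -big_split; apply: eq_bigr => j _.
by rewrite !mxE !mulrDl !mulrA.
Qed.

Lemma oct_mul_linearr p : linear (oct_mul p).
Proof.
move=> a q q'; apply/rowP => k; rewrite !mxE mulr_sumr -big_split.
apply: eq_bigr => i _; rewrite mulr_sumr -big_split; apply: eq_bigr => j _.
rewrite !mxE !(mulrDl, mulrDr) !mulrA; congr (_ * _ * _ + _); exact: mulrC.
Qed.

Lemma oct_conj_basis i : oct_conj (e i) = (-1) ^+ (i != ord0) *: e i.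
Proof.
apply/rowP => k; rewrite !mxE eqxx /=; case: (eqVneq k i) => [->|_].
  by case: eqP => _; rewrite ?mul1r ?mulN1r.
by rewrite mulr0 oppr0 if_same.
Qed.

End OctonionTable.

(** * Left and right multiplications on a bimodule *)

Section Actions.
Variable R : realType.
Local Notation e := (oct_e R).

Section Left.
Variable M : octLmodType R.
Implicit Types (p q r : octonion R) (x : M).

Lemma lactDl p q x : (p + q) *L x = p *L x + q *L x.
Proof. exact: (linD (lact_linearl x)). Qed.

Lemma lactZl a p x : (a *: p) *L x = a *: (p *L x).
Proof. exact: (linZ (lact_linearl x)). Qed.

Lemma lact_suml x I (s : seq I) (F : I -> octonion R) :
  (\sum_(i <- s) F i) *L x = \sum_(i <- s) F i *L x.
Proof. exact: (lin_sum (lact_linearl x)). Qed.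

Lemma lactDr p x y : p *L (x + y) = p *L x + p *L y.
Proof. exact: (linD (lact_linearr p)). Qed.

Lemma lactZr a p x : p *L (a *: x) = a *: (p *L x).
Proof. exact: (linZ (lact_linearr p)). Qed.

Lemma lact_basis p x : p *L x = \sum_i p ord0 i *: (e i *L x).
Proof.
by rewrite {1}[p]oct_basis lact_suml; apply: eq_bigr => i _; rewrite lactZl.
Qed.

Lemma lact_anticomm p q x :
  p *L (q *L x) + q *L (p *L x) = (p *O q + q *O p) *L x.
Proof.
have := lact_alt (p + q) x.
rewrite (linD (oct_mul_linearl _)) !(linD (oct_mul_linearr _)) !(lactDl, lactDr).
rewrite !lact_alt -!addrA => /addrI; rewrite !addrA => /addIr <-.
by rewrite addrC.
Qed.

Lemma lassoc_linearl q x : linear (fun p => lassoc p q x).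
Proof.
move=> a p p'; rewrite /lassoc oct_mul_linearl !lactDl !lactZl scalerBr.
by rewrite opprD addrACA.
Qed.

Lemma lassoc_linearr p x : linear (fun q => lassoc p q x).
Proof.
move=> a q q'; rewrite /lassoc oct_mul_linearr !lactDl !lactZl lactDr lactZr.
by rewrite scalerBr opprD addrACA.
Qed.

Lemma lassoc_basis p q x :
  lassoc p q x = \sum_i \sum_j (p ord0 i * q ord0 j) *: lassoc (e i) (e j) x.
Proof.
rewrite {1}[p]oct_basis (lin_sum (lassoc_linearl q x)); apply: eq_bigr => i _.
rewrite (linZ (lassoc_linearl q x)) {1}[q]oct_basis (lin_sum (lassoc_linearr _ x)).
rewrite scaler_sumr; apply: eq_bigr => j _.
by rewrite (linZ (lassoc_linearr _ x)) scalerA.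
Qed.

Lemma lassoc_antisym p q x : lassoc p q x = - lassoc q p x.
Proof.
apply/eqP; rewrite -addr_eq0 /lassoc addrACA -opprD lact_anticomm lactDl.
by rewrite subrr.
Qed.

End Left.

Section Bimodule.
Variable M : octBimodType R.
Implicit Types (p q r : octonion R) (x : M).

Lemma ractDl p x y : (x + y) *R p = x *R p + y *R p.
Proof. exact: (linD (ract_linearl p)). Qed.

Lemma ractZl p a x : (a *: x) *R p = a *: (x *R p).
Proof. exact: (linZ (ract_linearl p)). Qed.

Lemma ractBr x p q : x *R (p - q) = x *R p - x *R q.
Proof. exact: (linB (ract_linearr x)). Qed.

Lemma ractZr x a p : x *R (a *: p) = a *: (x *R p).
Proof. exact: (linZ (ract_linearr x)). Qed.

Lemma ract_basis p x : x *R p = \sum_i p ord0 i *: (x *R e i).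
Proof.
rewrite {1}[p]oct_basis (lin_sum (ract_linearr x)).
by apply: eq_bigr => i _; rewrite ractZr.
Qed.

Lemma ract_ract p q x : (x *R p) *R q = x *R (p *O q) + lassoc p q x.
Proof. by rewrite lassoc_rassoc addrC subrK. Qed.

Lemma lact_ract p q x : (q *L x) *R p = q *L (x *R p) + lassoc p q x.
Proof. by rewrite lassoc_massoc addrC subrK. Qed.

(** Right multiplication by an associator only depends on left
    multiplications.  Expanding ((x p) q) r from the inside and from the outside
    expresses x ((p q) r) - x (p (q r)) through [q, r, x p] and [p, q, x] r;
    doing the same with ((q x) p) r gives a second relation between these two
    terms, in which [r, q, x p] = - [q, r, x p], so that both disappear. *)
Lemma ract_associator p q r x :
  x *R ((p *O q) *O r - p *O (q *O r)) =
    lassoc p (q *O r) x - lassoc (p *O q) r x - lassoc (p *O r) q x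
    - lassoc p r (q *L x) + q *L lassoc p r x.
Proof.
have E1 : x *R (p *O q *O r) + lassoc (p *O q) r x + lassoc p q x *R r =
    x *R (p *O (q *O r)) + lassoc p (q *O r) x + lassoc q r (x *R p).
  by rewrite -!ract_ract -ractDl -ract_ract.
have E2 : q *L lassoc p r x + lassoc r q (x *R p) + lassoc p q x *R r =
    lassoc (p *O r) q x + lassoc p r (q *L x).
  apply: (addrI (q *L (x *R (p *O r)))).
  rewrite 3!(addrA (q *L _)) -lactDr -ract_ract -!lact_ract -ractDl -lact_ract.
  exact: ract_ract.
rewrite (lassoc_antisym r q) in E2; rewrite ractBr.
move: (x *R (_ *O r)) (x *R (p *O _)) (lassoc p q x *R r) E1 E2 => a d c.
move: (lassoc p (_ *O _) x) (lassoc (_ *O _) r x) (lassoc q r _) => e' b f.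
move: (lassoc (_ *O _) q x) (lassoc p r (q *L x)) (q *L _) => i j h E1.
rewrite -addrA addrC => /(canRL (addrK _)) Ec.
move: E1 => /(canRL (addrK _)) /(canRL (addrK _)) ->.
have -> : d + e' + f - c = d + e' + (h - i - j).
  rewrite -(addrA (d + e')); congr (_ + _).
  by rewrite -[f - c]opprK opprB [c - f]addrC Ec opprB opprD addrA.
rewrite addrC !addrA addNr add0r.
by rewrite [LHS](ACl (1*5*3*4*2)).
Qed.

End Bimodule.

End Actions.

(** * Linear combinations of words in the left multiplications *)

(** A word stands for the composite of the left multiplications by its letters,
    and a [wpoly] for an integral combination of words.  Integral coefficients
    are enough, denominators being cleared beforehand, and can be evaluated. *)
Definition word : predArgType := seq 'I_8.
Definition wpoly : predArgType := seq (int * word).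

Definition signz (b : bool) (c : int) : int := if b then - c else c.

Definition pmul (f g : wpoly) : wpoly :=
  [seq (s.1 * t.1, s.2 ++ t.2) | s <- f, t <- g].
Definition pscale (c : int) (f : wpoly) : wpoly := [seq (c * t.1, t.2) | t <- f].
Definition psub (f g : wpoly) : wpoly := f ++ pscale (- 1) g.

Fixpoint add_term (t : int * word) (f : wpoly) : wpoly :=
  match f with
  | [::] => [:: t]
  | s :: f' => if s.2 == t.2 then (s.1 + t.1, s.2) :: f' else s :: add_term t f'
  end.

(** [red] rewrites a word to another one up to a sign, [true] meaning minus. *)
Definition collect (red : word -> bool * word) (f : wpoly) : wpoly :=
  foldr (fun t => add_term (signz (red t.2).1 t.1, (red t.2).2)) [::] f.

Definition vanishes (red : word -> bool * word) (f : wpoly) : bool :=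
  all (fun t => t.1 == 0) (collect red f).

Section Evaluation.
Variables (R : realType) (M : octLmodType R).
Local Notation e := (oct_e R).
Implicit Types (x : M) (w : word) (f g : wpoly).

Definition act w x : M := foldr (fun i => lact (e i)) x w.

Definition ev f x : M := \sum_(t <- f) (t.1%:~R : R) *: act t.2 x.

Lemma act_cat u w x : act (u ++ w) x = act u (act w x).
Proof. exact: foldr_cat. Qed.

Lemma act_linear w : linear (act w).
Proof.
by elim: w => [//|i w IHw] a x y /=; rewrite IHw lactDr lactZr.
Qed.

Lemma actZ w a x : act w (a *: x) = a *: act w x.
Proof. exact: (linZ (act_linear w)). Qed.

Lemma ev_linear f : linear (ev f).
Proof.
move=> a x y; rewrite /ev scaler_sumr -big_split; apply: eq_bigr => t _.
by rewrite act_linear scalerDr !scalerA mulrC.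
Qed.

Lemma ev1 c w x : ev [:: (c, w)] x = (c%:~R : R) *: act w x.
Proof. exact: big_seq1. Qed.

Lemma ev_cons c w f x : ev ((c, w) :: f) x = (c%:~R : R) *: act w x + ev f x.
Proof. exact: big_cons. Qed.

Lemma ev_cat f g x : ev (f ++ g) x = ev f x + ev g x.
Proof. exact: big_cat. Qed.

Lemma ev_flatten I (s : seq I) (F : I -> wpoly) x :
  ev (flatten [seq F i | i <- s]) x = \sum_(i <- s) ev (F i) x.
Proof. by rewrite /ev big_flatten big_map. Qed.

Lemma ev_scale c f x : ev (pscale c f) x = (c%:~R : R) *: ev f x.
Proof.
rewrite /ev big_map scaler_sumr; apply: eq_bigr => t _.
by rewrite /= intrM scalerA.
Qed.

Lemma ev_sub f g x : ev (psub f g) x = ev f x - ev g x.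
Proof. by rewrite ev_cat ev_scale scaleN1r. Qed.

Lemma ev_mul f g x : ev (pmul f g) x = ev f (ev g x).
Proof.
rewrite {1}/ev big_allpairs_dep; apply: eq_bigr => s _.
rewrite (lin_sum (act_linear s.2)) scaler_sumr; apply: eq_bigr => t _.
by rewrite actZ scalerA /= intrM act_cat.
Qed.

Lemma signzE b c : (signz b c)%:~R = (-1) ^+ b * c%:~R :> R.
Proof. by case: b; rewrite ?mul1r // mulN1r mulrNz. Qed.

Lemma ev_add_term t f x : ev (add_term t f) x = (t.1%:~R : R) *: act t.2 x + ev f x.
Proof.
elim: f => [|[c w] f IHf] /=; first by rewrite /ev big_seq1 big_nil addr0.
case: eqP => [->|_]; rewrite !ev_cons; last by rewrite IHf addrCA.
by rewrite intrD scalerDl addrA [(c%:~R : R) *: _ + _]addrC.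
Qed.

(** The soundness of [red] is required at the vector [x] only: some
    rewritings are valid on A(M) but not on the whole module. *)
Lemma vanishesP (red : word -> bool * word) x :
    (forall w, act w x = (-1) ^+ (red w).1 *: act (red w).2 x) ->
  forall f, vanishes red f -> ev f x = 0.
Proof.
move=> redP f /allP f0; have -> : ev f x = ev (collect red f) x.
  elim: f {f0} => [//|[c w] f IHf]; rewrite ev_cons /= ev_add_term IHf redP.
  by rewrite scalerA signzE mulrC.
by rewrite /ev big_seq big1 // => t /f0 /eqP ->; rewrite scale0r.
Qed.

Lemma vanishes_eq (red : word -> bool * word) x :
    (forall w, act w x = (-1) ^+ (red w).1 *: act (red w).2 x) ->
  forall f g, vanishes red (psub f g) -> ev f x = ev g x.
Proof.
by move=> redP f g /(vanishesP redP); rewrite ev_sub => /eqP; rewrite subr_eq0 => /eqP.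
Qed.

End Evaluation.

(** * Normal forms in the Clifford algebra *)

(** Moves a letter [i != ord0] to its place in an increasing word.  The test
    [j != ord0] keeps the sign right on words with a letter 0, which acts as
    the identity and so commutes with everything. *)
Fixpoint insert_unit (i : 'I_8) (w : word) : bool * word :=
  match w with
  | [::] => (false, [:: i])
  | j :: w' => if (i < j)%N then (false, i :: w)
     else if i == j then (true, w')
     else let: (s, u) := insert_unit i w' in ((j != ord0) (+) s, j :: u)
  end.

Definition clifford_nf (w : word) : bool * word :=
  foldr (fun i a => if i == ord0 then a else
    let: (s, u) := insert_unit i a.2 in (a.1 (+) s, u)) (false, [::]) w.

Section Clifford.
Variables (R : realType) (M : octLmodType R).
Local Notation e := (oct_e R).
Implicit Types (x : M) (w : word) (f g : wpoly).

Lemma lact_sq i x : i != ord0 -> e i *L (e i *L x) = - x.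
Proof.
have tab : i != ord0 -> osgn i i && (oxor i i == ord0).
  apply/implyP; move: i; apply: all_indices; by vm_compute.
move/tab/andP => [si /eqP oi].
by rewrite lact_alt oct_mul_basis si oi lactZl lact1 scaleN1r.
Qed.

Lemma lact_swap i j x : i != ord0 -> j != ord0 -> i != j ->
  e i *L (e j *L x) = - (e j *L (e i *L x)).
Proof.
have tab : [&& i != ord0, j != ord0 & i != j] ==>
    (osgn j i == ~~ osgn i j) && (oxor j i == oxor i j).
  by move: i j; apply: all_indices2; vm_compute.
move=> i0 j0 ij; move: tab; rewrite i0 j0 ij => /andP[/eqP sC /eqP oC].
apply/eqP; rewrite -addr_eq0 lact_anticomm !oct_mul_basis sC oC -scalerDl.
by case: osgn; rewrite ?addNr ?subrr scale0r (lin0 (lact_linearl x)).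
Qed.

Lemma act_insert_unit i w x : i != ord0 ->
  e i *L act w x = (-1) ^+ (insert_unit i w).1 *: act (insert_unit i w).2 x.
Proof.
move=> i0; elim: w => [|j w IHw] /=; first by rewrite scale1r.
case: ifP => _ /=; first by rewrite scale1r.
case: eqP => [<-|/eqP ij] /=; first by rewrite lact_sq // scaleN1r.
case: (insert_unit i w) IHw => s u /= IHw; rewrite signr_addb -scalerA -lactZr -IHw.
case: (eqVneq j ord0) => [->|j0] /=; first by rewrite !lact1 scale1r.
by rewrite scaleN1r lact_swap.
Qed.

Lemma act_clifford_nf w x :
  act w x = (-1) ^+ (clifford_nf w).1 *: act (clifford_nf w).2 x.
Proof.
elim: w => [|i w IHw] /=; first by rewrite scale1r.
case: (eqVneq i ord0) => [->|i0]; first by rewrite lact1.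
rewrite IHw lactZr act_insert_unit // scalerA -signr_addb.
by case: (insert_unit i _) => s u.
Qed.

End Clifford.

(** * Right multiplication in terms of left multiplication *)

Definition associator_poly (i j : 'I_8) : wpoly :=
  [:: (signz (osgn i j) 1, [:: oxor i j]); (- 1, [:: i; j])].

(** The right-hand side of [ract_associator] for three basis elements. *)
Definition ract_associator_poly (i j k : 'I_8) : wpoly :=
  pscale (signz (osgn j k) 1) (associator_poly i (oxor j k))
  ++ pscale (signz (~~ osgn i j) 1) (associator_poly (oxor i j) k)
  ++ pscale (signz (~~ osgn i k) 1) (associator_poly (oxor i k) j)
  ++ pscale (- 1) (pmul (associator_poly i k) [:: (1, [:: j])])
  ++ pmul [:: (1, [:: j])] (associator_poly i k).

(** The operator \sum_j L_(e_j) L_(conj(e_j) e_i) - 4 L_i.  For i != 0, the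
    terms j = 0 and j = i of the sum are both L_i, and the other six are
    L_j L_k with e_j e_k = e_i, each of the three lines through i occurring
    twice. *)
Definition ract_poly (i : 'I_8) : wpoly :=
  (- 4%:Z, [:: i])
  :: [seq (signz ((j != ord0) (+) osgn j i) 1, [:: j; oxor j i])
     | j <- oct_indices].

Section RightMultiplication.
Variables (R : realType) (M : octBimodType R).
Local Notation e := (oct_e R).
Implicit Types (x : M).

Lemma ev_associator i j x : ev (associator_poly i j) x = lassoc (e i) (e j) x.
Proof.
rewrite ev_cons ev1 signzE mulr1 scaleN1r /= /lassoc.
by rewrite oct_mul_basis lactZl.
Qed.

Lemma ev_ract_associator i j k x :
  ev (ract_associator_poly i j k) x =
  x *R ((e i *O e j) *O e k - e i *O (e j *O e k)).
Proof.
rewrite ract_associator !oct_mul_basis (linZ (lassoc_linearr _ _)).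
rewrite !(linZ (lassoc_linearl _ _)) 4!ev_cat !ev_scale !ev_mul !ev1.
rewrite !ev_associator /= !scale1r !signzE scaleN1r !mulr1.
move: (lassoc (e i) (e (oxor j k)) x) (lassoc (e (oxor i j)) _ x) => u v.
move: (lassoc (e (oxor i k)) _ x) (lassoc _ _ (_ *L _)) (_ *L lassoc _ _ _).
move=> w y z; rewrite !addrA.
by case: (osgn i j); case: (osgn i k); rewrite /= ?scaleN1r ?scale1r ?opprK.
Qed.

(** For i != 0, two units a, b such that a, b and i are not collinear.  Then a, b and
    c = a xor b xor i are not collinear either, and
    (e_a e_b) e_c = - e_a (e_b e_c) = +- e_i. *)
Definition transverse (i : 'I_8) : 'I_8 * 'I_8 :=
  (if i == inZp 1 then inZp 2 else inZp 1, if (i < 4)%N then inZp 4 else inZp 2).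

(** With a, b, c as above, twice e_i is, up to a sign, the associator of e_a,
    e_b and e_c, so [ract_associator] computes x e_i; the Clifford relations
    bring the result into a form that no longer depends on a and b. *)
Theorem ev_ract i x : ev (ract_poly i) x = 4 *: (x *R e i).
Proof.
case: (eqVneq i ord0) => [->|i0].
  rewrite ract1.
  have /(vanishes_eq (fun w => act_clifford_nf w x)) -> :
     vanishes clifford_nf (psub (ract_poly ord0) [:: (4%:Z, [::])]) by vm_compute.
  exact: ev1.
pose a := (transverse i).1; pose b := (transverse i).2; pose c := oxor (oxor a b) i.
pose s := osgn a b (+) osgn (oxor a b) c.
have : (i != ord0) ==> [&& oxor (oxor a b) c == i, oxor a (oxor b c) == i,
   osgn b c (+) osgn a (oxor b c) == ~~ s
   & vanishes clifford_nf
       (psub (pscale (signz s 2) (ract_associator_poly a b c)) (ract_poly i))].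
  rewrite {}/s {}/c {}/a {}/b; move: i {i0}; apply: all_indices; by vm_compute.
rewrite i0 => /and4P[/eqP w1 /eqP w2 /eqP s2].
move/(vanishes_eq (fun w => act_clifford_nf w x)) <-.
rewrite ev_scale ev_ract_associator !oct_mul_basis.
rewrite (linZ (oct_mul_linearl _)) (linZ (oct_mul_linearr _)) !oct_mul_basis.
rewrite w1 w2 !scalerA -!signr_addb s2 -/s -scalerBl ractZr scalerA signzE.
congr (_ *: _); case: (s) => /=; rewrite ?mul1r ?mulN1r; ring.
Qed.

End RightMultiplication.

(** * The volume relation *)

Definition imag_units : word := behead oct_indices.

(** The relation L_1 ... L_7 = -1 turns an increasing word of length n > 3
    into its complement, of length 7 - n; the negation of [s] is its sign. *)
Definition spin_nf (w : word) : bool * word :=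
  let: (s, u) := clifford_nf w in
  if (size u <= 3)%N then (s, u)
  else let: (t, v) := clifford_nf (u ++ imag_units) in (~~ s (+) t, v).

Section Volume.
Variables (R : realType) (M : octBimodType R).
Local Notation e := (oct_e R).
Implicit Types (w : word) (x : M).

(** Let r = 4 R_1 = 2 (S - L_1), where S is the sum of the three commuting
    square roots B = L_j L_k of -1 with e_j e_k = e_1.  Let w be the product of
    L_1 and the three B's, so that w = - L_1 ... L_7 and w^2 = 1, and let
    t = L_1 S.  A product of two of the B's is w L_1 times the third, hence
    r^2 + 16 = 8 (w - 1) t and t^2 = 3 - 2 w t.  Where w = -1 the latter reads
    t (t - 2) = 3, so that
      (L_1 r - 6) (r^2 + 16) = 16 (w - 1) t (t - 2) = 48 (w - 1).
    As R_1^2 = -1, the left-hand side is 0 and w = 1. *)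
Lemma act_imag_units x : act imag_units x = - x.
Proof.
pose i : 'I_8 := inZp 1; pose r := ract_poly i.
have sq : ev ((16%:Z, [::]) :: pmul r r) x = 0.
  rewrite ev_cons ev_mul !ev_ract ractZl.
  rewrite ract_ract oct_mul_basis ractZr.
  have [-> ->] : osgn i i = true /\ oxor i i = ord0 by split => //; apply: val_inj.
  have /eqP := lassoc_antisym (e i) (e i) x; rewrite -addr_eq0 -mulr2n -scaler_nat.
  rewrite scaler_eq0 pnatr_eq0 => /eqP->.
  rewrite addr0 ract1 scaleN1r !scalerA !scalerN -natrM; exact: subrr.
have := ev_mul (psub (pmul [:: (1, [:: i])] r) [:: (6%:Z, [::])])
               ((16%:Z, [::]) :: pmul r r) x.
rewrite sq (lin0 (ev_linear _)).
rewrite (vanishes_eq (fun w => act_clifford_nf w x)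
          (g := [:: (- 48%:Z, [::]); (- 48%:Z, imag_units)])).
  rewrite ev_cons ev1 -scalerDr => /eqP.
  by rewrite scaler_eq0 intr_eq0 /= addrC addr_eq0 => /eqP.
by vm_compute.
Qed.

Lemma act_spin_nf w x : act w x = (-1) ^+ (spin_nf w).1 *: act (spin_nf w).2 x.
Proof.
rewrite /spin_nf act_clifford_nf; case: (clifford_nf w) => s u /=.
case: ifP => // _; have := act_clifford_nf (u ++ imag_units) x.
case: (clifford_nf _) => t v /=.
rewrite act_cat act_imag_units -scaleN1r actZ scaleN1r => E.
by rewrite signr_addb -scalerA -E; case: s; rewrite /= ?scale1r ?scaleN1r ?opprK.
Qed.

End Volume.

(** * The real part *)

(** On A(M) the products of a word may be taken in the octonions, which leaves
    one letter. *)
Definition nuclear_nf (w : word) : bool * word :=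
  let: (s, k) := foldr (fun i a => (a.1 (+) osgn i a.2, oxor i a.2))
                       (false, ord0) w in (s, [:: k]).

(** The operator 48 T = 20 - \sum_i (4 R_i) L_i, with i from 1 to 7. *)
Definition re_poly : wpoly :=
  (20%:Z, [::]) ::
  flatten [seq pmul (pscale (- 1) (ract_poly i)) [:: (1, [:: i])]
          | i <- imag_units].

Section RealPart.
Variables (R : realType) (M : octBimodType R).
Local Notation e := (oct_e R).
Implicit Types (p q : octonion R) (x : M).

Lemma act_nuclear_nf w x : assoc_elt x ->
  act w x = (-1) ^+ (nuclear_nf w).1 *: act (nuclear_nf w).2 x.
Proof.
move=> Ax; rewrite /nuclear_nf; elim: w => [|i w /=]; first by rewrite /= scale1r lact1.
case: (foldr _ _ w) => s k /= ->.
have /eqP := Ax (e i) (e k); rewrite subr_eq0 lactZr => /eqP <-.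
by rewrite oct_mul_basis lactZl scalerA signr_addb.
Qed.

Definition re_op x : M :=
  (5 / 12) *: x - (1 / 12) *: \sum_(i < 8 | i != ord0) (e i *L x) *R e i.

Lemma big_imag_units (F : 'I_8 -> M) :
  \sum_(i < 8 | i != ord0) F i = \sum_(i <- imag_units) F i.
Proof.
rewrite big_mkcond big_indices big_cons /= add0r; apply: eq_big_seq => i.
suff /allP/(_ i) im : all (fun i => i != ord0) imag_units by move/im ->.
by vm_compute.
Qed.

Lemma ev_re_poly x : ev re_poly x = 48 *: re_op x.
Proof.
rewrite ev_cons ev_flatten /re_op scalerBr !scalerA; congr (_ + _).
  by congr (_ *: _); field.
rewrite big_imag_units -scaleNr scaler_sumr; apply: eq_bigr => i _.
rewrite ev_mul ev_scale ev_ract ev1 /= !scale1r !scalerA; congr (_ *: _).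
by field.
Qed.

Lemma re_op_ev0 f x : vanishes spin_nf (pmul re_poly f) -> re_op (ev f x) = 0.
Proof.
move=> /(vanishesP (fun w => act_spin_nf w x)) /eqP.
by rewrite ev_mul ev_re_poly scaler_eq0 pnatr_eq0 => /eqP.
Qed.

Lemma re_op_linear : linear re_op.
Proof.
move=> a x y; apply: (@scalerI _ _ (48 : R)); first by rewrite pnatr_eq0.
rewrite [RHS]scalerDr scalerA mulrC -scalerA -!ev_re_poly; exact: ev_linear.
Qed.

Lemma re_op_assoc x : assoc_elt (re_op x).
Proof.
move=> p q; rewrite lassoc_basis big1 // => i _; rewrite big1 // => j _.
suff -> : lassoc (e i) (e j) (re_op x) = 0 by rewrite scaler0.
have /(vanishesP (fun w => act_spin_nf w x)) /eqP :
    vanishes spin_nf (pmul (associator_poly i j) re_poly).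
  by move: i j; apply: all_indices2; vm_compute.
rewrite ev_mul ev_re_poly (linZ (ev_linear _)) ev_associator.
by rewrite scaler_eq0 pnatr_eq0 => /eqP.
Qed.

Lemma re_op_lassoc p q x : re_op (lassoc p q x) = 0.
Proof.
rewrite lassoc_basis (lin_sum re_op_linear) big1 // => i _.
rewrite (lin_sum re_op_linear) big1 // => j _.
rewrite (linZ re_op_linear) -ev_associator re_op_ev0 ?scaler0 //.
by move: i j; apply: all_indices2; vm_compute.
Qed.

Lemma re_op_commutator p x : re_op (commutator p x) = 0.
Proof.
rewrite /commutator lact_basis ract_basis -sumrB (lin_sum re_op_linear) big1 // => i _.
rewrite -scalerBr (linZ re_op_linear).
suff -> : re_op (e i *L x - x *R e i) = 0 by rewrite scaler0.
apply: (@scalerI _ _ (4 : R)); first by rewrite pnatr_eq0.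
rewrite scaler0 -(linZ re_op_linear) scalerBr -ev_ract.
rewrite -[X in X - _](ev1 4%:Z [:: i]) -ev_sub re_op_ev0 //.
by move: i; apply: all_indices; vm_compute.
Qed.

Lemma re_op_lact_nuclear i x : assoc_elt x ->
  re_op (e i *L x) = if i == ord0 then x else 0.
Proof.
move=> Ax; apply: (@scalerI _ _ (48 : R)); first by rewrite pnatr_eq0.
pose g : wpoly := if i == ord0 then [:: (48%:Z, [::])] else [::].
have /(vanishes_eq (fun w => act_nuclear_nf w Ax)) :
    vanishes nuclear_nf (psub (pmul re_poly [:: (1, [:: i])]) g).
  by rewrite {}/g; move: i; apply: all_indices; vm_compute.
rewrite ev_mul ev1 scale1r ev_re_poly => ->; rewrite /g.
by case: eqP => _; [exact: ev1 | rewrite scaler0 /ev big_nil].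
Qed.

(** An identity of multiplication operators; together with [re_op_assoc] it
    shows that M is the sum of the e_i A(M). *)
Lemma re_op_decomposition x :
  x = \sum_i e i *L re_op (oct_conj (e i) *L x).
Proof.
apply: (@scalerI _ _ (48 : R)); first by rewrite pnatr_eq0.
pose f i : wpoly :=
  pmul [:: (1, [:: i])] (pmul re_poly [:: (signz (i != ord0) 1, [:: i])]).
have /(vanishes_eq (fun w => act_spin_nf w x)) :
    vanishes spin_nf (psub [:: (48%:Z, [::])] (flatten [seq f i | i <- oct_indices])).
  by vm_compute.
rewrite ev1 ev_flatten => ->; rewrite big_indices scaler_sumr; apply: eq_bigr => i _.
rewrite !ev_mul !ev1 scale1r signzE mulr1 ev_re_poly /= lactZr.
by rewrite oct_conj_basis lactZl.
Qed.

Lemma re_op_nuclear_sum (c : 'I_8 -> M) : (forall i, assoc_elt (c i)) ->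
  re_op (\sum_i e i *L c i) = c ord0.
Proof.
move=> Ac; rewrite (lin_sum re_op_linear) (bigD1 ord0) //= re_op_lact_nuclear //.
rewrite big1 ?addr0 // => i /negbTE i0; by rewrite re_op_lact_nuclear // i0.
Qed.

(** [re_op_nuclear_sum] reads off c_0 from any decomposition of x, which gives
    uniqueness; existence is [re_op_decomposition]. *)
Lemma reE x : re x = re_op x.
Proof.
rewrite /re; apply: xget_unique => [|y [c [Ac -> ->]]].
  exists (fun i => re_op (oct_conj (e i) *L x)); split.
  - by move=> i; exact: re_op_assoc.
  - exact: re_op_decomposition.
  by rewrite oct_conj_basis scale1r lact1.
by rewrite re_op_nuclear_sum.
Qed.

Lemma re_op_lact_re p x : re_op (p *L re_op x) = oct_re p *: re_op x.
Proof.
have -> : p *L re_op x = \sum_i e i *L (p ord0 i *: re_op x).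
  by rewrite lact_basis; apply: eq_bigr => i _; rewrite lactZr.
rewrite re_op_nuclear_sum // => i q r.
have := re_op_assoc x q r; rewrite /lassoc !lactZr -scalerBr => ->.
exact: scaler0.
Qed.

End RealPart.

Theorem theorem3p1 (R : realType) (M : octBimodType R) :
  (forall x : M,
     re x = (5 / 12) *: x
            - (1 / 12) *: \sum_(i < 8 | i != ord0)
                            (oct_e R i *L x) *R oct_e R i)
  /\ (forall x : M,
     [/\ re (re x) = re x,
         (forall p q : octonion R,
            [/\ re (p *L re x) = oct_re p *: re x,
                re (lassoc p q x) = 0
              & re (commutator p x) = 0])
       & x = \sum_(i < 8) oct_e R i *L re (oct_conj (oct_e R i) *L x)]).
Proof.
split=> x; first exact: reE.
rewrite !reE; split.
- have := re_op_lact_re (oct_e R ord0) x.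
  by rewrite lact1 /oct_re mxE eqxx scale1r.
- by move=> p q; rewrite !reE re_op_lact_re re_op_lassoc re_op_commutator.
rewrite {1}[x]re_op_decomposition; apply: eq_bigr => i _.
by rewrite reE.
Qed.
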